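(* Let $X$ be a pointed metric space and $E$ a Banach space over $\mathbb{K}$. Then the Lipschitz injective norm $\varepsilon$ is a uniform and dualizable Lipschitz cross-norm on $X\boxtimes E$.
   Context: $\mathbb{K}$ is $\mathbb{R}$ or $\mathbb{C}$. A pointed metric space $X$ is a metric space (with metric $d$) with a distinguished base point $0$. For pointed metric spaces $X,Y$ (a Banach space being pointed by its zero vector), $\mathrm{Lip}_0(X,Y)$ is the set of all Lipschitz maps $f\colon X\to Y$ with $f(0)=0$, and $\mathrm{Lip}(f)$ is the least Lipschitz constant; $X^\#=\mathrm{Lip}_0(X,\mathbb{K})$, normed by $\mathrm{Lip}$. $B_Z$ denotes the closed unit ball of a normed space $Z$. $E^*$ is the topological dual of $E$ and $\langle\phi,e\rangle=\phi(e)$; $V'$ denotes the algebraic dual of a vector space $V$; $\mathcal{L}(E;E)$ is the space of bounded linear operators on $E$. For $x,y\in X$ and $e\in E$, $\delta_{(x,y)}\boxtimes e\in \mathrm{Lip}_0(X,E^* )'$ is the linear functional $f\mapsto\langle f(x)-f(y),e\rangle$. The Lipschitz tensor product $X\boxtimes E$ is the linear subspace of $\mathrm{Lip}_0(X,E^* )'$ spanned by all the functionals $\delta_{(x,y)}\boxtimes e$ with $x,y\in X$, $e\in E$. Every $u\in X\boxtimes E$ can be written (non-uniquely) as $u=\sum_{i=1}^n\delta_{(x_i,y_i)}\boxtimes e_i$. For $u=\sum_{i=1}^n \delta_{(x_i,y_i)}\boxtimes e_i\in X\boxtimes E$ (independently of the representation), $$\varepsilon(u)=\sup\left\{\left|\sum_{i=1}^n(g(x_i)-g(y_i))\langle\phi,e_i\rangle\right|\colon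 g\in B_{X^\#},\ \phi\in B_{E^*}\right\}.$$ A norm $\alpha$ on $X\boxtimes E$ is a Lipschitz cross-norm if $\alpha(\delta_{(x,y)}\boxtimes e)=d(x,y)\|e\|$ for all $x,y\in X$, $e\in E$. A Lipschitz cross-norm $\alpha$ is dualizable if for all $g\in X^\#$, $\phi\in E^*$ and all $\sum_{i=1}^n\delta_{(x_i,y_i)}\boxtimes e_i\in X\boxtimes E$, $\left|\sum_{i=1}^n(g(x_i)-g(y_i))\langle\phi,e_i\rangle\right|\leq\mathrm{Lip}(g)\|\phi\|\,\alpha\left(\sum_{i=1}^n \delta_{(x_i,y_i)}\boxtimes e_i\right)$. It is uniform if for all $h\in\mathrm{Lip}_0(X,X)$, $T\in\mathcal{L}(E;E)$ and all $\sum_{i=1}^n\delta_{(x_i,y_i)}\boxtimes e_i\in X\boxtimes E$, $\alpha\left(\sum_{i=1}^n\delta_{(h(x_i),h(y_i))}\boxtimes T(e_i)\right)\leq\mathrm{Lip}(h)\|T\|\,\alpha\left(\sum_{i=1}^n \delta_{(x_i,y_i)}\boxtimes e_i\right)$. *)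

(* Defs.v *)
From HB Require Import structures.
From mathcomp Require Import all_boot all_order all_algebra.
From mathcomp Require Import complex.
From mathcomp Require Import all_classical all_reals all_analysis.
Set Implicit Arguments.
Unset Strict Implicit.
Unset Printing Implicit Defensive.
Import Order.TTheory GRing.Theory Num.Theory.
Import numFieldNormedType.Exports.
Local Open Scope classical_set_scope.
Local Open Scope ring_scope.

Variant scalar_kind := RealScalars | ComplexScalars.

Definition scalars (R : realType) (k : scalar_kind) : numFieldType :=
  match k with RealScalars => R | ComplexScalars => R[i] end.

(* Norms of a [normedModType K] take values in [K], as (real) nonnegative
   elements; [rpart] brings them back to [R] when K is R[i]. *)
Definition rpart (R : realType) (k : scalar_kind) : scalars R k -> R :=
  match k with RealScalars => id | ComplexScalars => @complex.Re R end.

Section RealNorm.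
Context (R : realType) (k : scalar_kind).
Local Notation K := (scalars R k).

Definition rnorm (V : normedModType K) (v : V) : R := rpart `|v|.

Definition rdist (V : normedModType K) (v w : V) : R := rnorm (v - w).

Lemma rpart0 : rpart (0 : K) = 0. Proof. by case: k. Qed.

Lemma rpartD (a b : K) : rpart (a + b) = rpart a + rpart b.
Proof. by case: k a b => //= - [? ?] [? ?]. Qed.

Lemma rpartM (a b : K) : 0 <= b -> rpart (a * b) = rpart a * rpart b.
Proof.
case: k a b => //= -[ar ai] [br bi].
by rewrite lecE /= => /andP[/eqP -> _]; rewrite mulr0 subr0.
Qed.

Lemma ler_rpart (a b : K) : a <= b -> rpart a <= rpart b.
Proof.
by case: k a b => //= -[ar ai] [br bi]; rewrite lecE /= => /andP[_].
Qed.

Lemma rpart_eq0 (a : K) : 0 <= a -> rpart a = 0 -> a = 0.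
Proof.
case: k a => //= -[ar ai].
by rewrite lecE /= => /andP[/eqP -> _] ->.
Qed.

Section Lemmas.
Context (V : normedModType K).
Implicit Types v w : V.

Lemma rnorm_ge0 v : 0 <= rnorm v.
Proof. by rewrite -rpart0 ler_rpart. Qed.

Lemma rnorm0 : rnorm (0 : V) = 0.
Proof. by rewrite /rnorm normr0 rpart0. Qed.

Lemma rnorm_eq0 v : rnorm v = 0 -> v = 0.
Proof. by move=> /rpart_eq0 v0; apply/normr0_eq0/v0. Qed.

Lemma rnormD v w : rnorm (v + w) <= rnorm v + rnorm w.
Proof. by rewrite -rpartD ler_rpart// ler_normD. Qed.

Lemma rnormZ (a : K) v : rnorm (a *: v) = rnorm (a : K^o) * rnorm v.
Proof. by rewrite /rnorm normrZ rpartM. Qed.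

End Lemmas.
End RealNorm.

Section OperatorNorm.
Context (R : realType) (k : scalar_kind).
Local Notation K := (scalars R k).

Definition bounded_operator (V W : normedModType K) (T : V -> W) : Prop :=
  exists c : R, forall v, rnorm (T v) <= c * rnorm v.

Definition opnorm (V W : normedModType K) (T : V -> W) : R :=
  sup [set rnorm (T v) | v in [set v : V | rnorm v <= 1]].

Section Lemmas.
Context (V W : normedModType K).
Implicit Types T S : V -> W.

Lemma continuous_bounded_operator T :
  linear T -> continuous T -> bounded_operator T.
Proof.
move=> linT cT.
pose f : {linear V -> W} := HB.pack T (GRing.isLinear.Build K V W *:%R T linT).
have /linear_boundedP /pinfty_ex_gt0 [c c0 Bc] : bounded_near f (nbhs 0).
  exact/linear_bounded_continuous.
exists (rpart c) => v.
by have /ler_rpart := Bc v; rewrite rpartM.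
Qed.

Lemma opnorm_has_sup T : bounded_operator T ->
  has_sup [set rnorm (T v) | v in [set v : V | rnorm v <= 1]].
Proof.
move=> [c Bc]; split.
  by exists (rnorm (T 0)), 0 => //=; rewrite rnorm0.
exists `|c| => _ [v /= v1 <-].
apply: (le_trans (Bc v)); apply: (@le_trans _ _ (`|c| * rnorm v)).
  by rewrite ler_wpM2r ?rnorm_ge0 ?ler_norm.
by rewrite ler_piMr.
Qed.

Lemma opnorm_ub T v : bounded_operator T -> rnorm v <= 1 ->
  rnorm (T v) <= opnorm T.
Proof.
move=> bT v1; apply: sup_upper_bound; first exact: opnorm_has_sup.
by exists v.
Qed.

Lemma opnorm_le T (c : R) : (forall v, rnorm v <= 1 -> rnorm (T v) <= c) ->
  opnorm T <= c.
Proof.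
move=> Tc; apply: ge_sup.
  by exists (rnorm (T 0)), 0 => //=; rewrite rnorm0.
by move=> _ [v /= v1 <-]; exact: Tc.
Qed.

Lemma opnorm_lin (a : K) T S : bounded_operator T -> bounded_operator S ->
  opnorm (a *: T + S) <= rnorm (a : K^o) * opnorm T + opnorm S.
Proof.
move=> bT bS; apply: opnorm_le => v v1.
apply: (le_trans (rnormD _ _)); rewrite rnormZ lerD ?opnorm_ub//.
by rewrite ler_wpM2l ?rnorm_ge0 ?opnorm_ub.
Qed.

Lemma opnorm0 : opnorm (0 : V -> W) = 0.
Proof.
apply/eqP; rewrite eq_le opnorm_le; last by move=> v _; rewrite rnorm0.
rewrite /= -[leLHS](rnorm0 W) -[in leLHS](erefl : (0 : V -> W) 0 = 0).
by apply: opnorm_ub; rewrite ?rnorm0//; exists 0 => v; rewrite mul0r rnorm0.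
Qed.

End Lemmas.
End OperatorNorm.

Section TopologicalDual.
Context (R : realType) (k : scalar_kind).
Local Notation K := (scalars R k).
Variable E : normedModType K.

Definition dual_pred : {pred E -> K^o} :=
  [pred phi : E -> K^o | `[< linear phi /\ continuous phi >]].

Lemma dual_submod_closed : submod_closed dual_pred.
Proof.
split.
  apply/asboolP; split=> [a u v|v]; last exact: cvg_cst.
  by change (0 = a *: (0 : K^o) + 0); rewrite scaler0 addr0.
move=> a f g /asboolP[lf cf] /asboolP[lg cg]; apply/asboolP; split.
  move=> b u v; rewrite /= !fctE lf lg !scalerDr !scalerA (mulrC a b).
  by rewrite addrACA.
by move=> v; apply: cvgD; [apply: cvgZr; exact: cf | exact: cg].
Qed.

HB.instance Definition _ :=
  GRing.isSubmodClosed.Build K (E -> K^o) dual_pred dual_submod_closed.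

Record dual := Dual { dual_val :> E -> K^o ; dual_valP : dual_val \in dual_pred }.
HB.instance Definition _ := [isSub for dual_val].
HB.instance Definition _ := [Choice of dual by <:].
HB.instance Definition _ := [SubChoice_isSubLmodule of dual by <:].

Definition dual_dist (phi psi : dual) : R := opnorm (phi - psi : dual).

Lemma dual_bounded (phi : dual) : bounded_operator phi.
Proof.
by case: phi => phi /= /asboolP[]; exact: continuous_bounded_operator.
Qed.

End TopologicalDual.

Section Lipschitz.
Context (R : realType) (X Y : Type).
Variables (dX : X -> X -> R) (dY : Y -> Y -> R).

Definition lip_consts (f : X -> Y) : set R :=
  [set c | 0 <= c /\ forall x y, dY (f x) (f y) <= c * dX x y].

Definition Lip (f : X -> Y) : R := inf (lip_consts f).

Definition is_lip0 (x0 : X) (y0 : Y) (f : X -> Y) : Prop :=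
  f x0 = y0 /\ lip_consts f !=set0.

End Lipschitz.

Section LipDual.
Context (R : realType) (k : scalar_kind).
Local Notation K := (scalars R k).
Context (X : metricType R) (x0 : X) (E : normedModType K).
Local Notation d := (@mdist R X).

Definition lip0_dual_pred : {pred X -> dual E} :=
  [pred f : X -> dual E | `[< is_lip0 d (@dual_dist R k E) x0 0 f >]].

Lemma lip0_dual_submod_closed : submod_closed lip0_dual_pred.
Proof.
split.
  apply/asboolP; split => //; exists 0; split => // x y.
  by rewrite mul0r /dual_dist /= subrr opnorm0.
move=> a f g /asboolP[f0 [c [c0 cf]]] /asboolP[g0 [c' [c'0 cg]]].
apply/asboolP; split; first by rewrite !fctE f0 g0 scaler0 addr0.
exists (rnorm (a : K^o) * c + c'); split.
  by rewrite addr_ge0// mulr_ge0// rnorm_ge0.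
move=> x y; rewrite /dual_dist !fctE.
have -> : \val (a *: f x + g x - (a *: f y + g y)) =
    a *: \val (f x - f y) + \val (g x - g y) :> (E -> K^o).
  by rewrite opprD addrACA -scalerBr.
apply: (le_trans (opnorm_lin _ (dual_bounded _) (dual_bounded _))).
rewrite mulrDl -mulrA lerD//; last exact: cg.
by rewrite ler_wpM2l ?rnorm_ge0//; exact: cf.
Qed.

HB.instance Definition _ :=
  GRing.isSubmodClosed.Build K (X -> dual E) lip0_dual_pred
    lip0_dual_submod_closed.

Record lip0_dual := Lip0Dual {
  lip0_dual_val :> X -> dual E ;
  lip0_dual_valP : lip0_dual_val \in lip0_dual_pred }.
HB.instance Definition _ := [isSub for lip0_dual_val].
HB.instance Definition _ := [Choice of lip0_dual by <:].
HB.instance Definition _ := [SubChoice_isSubLmodule of lip0_dual by <:].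

End LipDual.

Section AlgebraicDual.
Context (K : fieldType) (V : lmodType K).

Definition algdual_pred : {pred V -> K^o} :=
  [pred u : V -> K^o | `[< linear u >]].

Lemma algdual_submod_closed : submod_closed algdual_pred.
Proof.
split.
  apply/asboolP => a u v.
  by change (0 = a *: (0 : K^o) + 0); rewrite scaler0 addr0.
move=> a f g /asboolP lf /asboolP lg; apply/asboolP => b u v.
by rewrite !fctE lf lg !scalerDr !scalerA (mulrC a b) addrACA.
Qed.

HB.instance Definition _ :=
  GRing.isSubmodClosed.Build K (V -> K^o) algdual_pred algdual_submod_closed.

Record algdual := AlgDual {
  algdual_val :> V -> K^o ; algdual_valP : algdual_val \in algdual_pred }.
HB.instance Definition _ := [isSub for algdual_val].
HB.instance Definition _ := [Choice of algdual by <:].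
HB.instance Definition _ := [SubChoice_isSubLmodule of algdual by <:].

Definition span_pred (A : set V) : {pred V} :=
  [pred v | `[< exists (n : nat) (c : 'I_n -> K) (a : 'I_n -> V),
    (forall i, A (a i)) /\ v = \sum_(i < n) c i *: a i >]].

Lemma span_submod_closed (A : set V) : submod_closed (span_pred A).
Proof.
split.
  apply/asboolP; exists 0%N, (fun=> 0), (fun=> 0).
  by split=> [[]//|]; rewrite big_ord0.
move=> b _ _ /asboolP[n [c [a [Aa ->]]]] /asboolP[m [c' [a' [Aa' ->]]]].
apply/asboolP; exists (n + m)%N.
exists (fun i : 'I_(n + m) => match fintype.split i with inl j => b * c j | inr j => c' j end).
exists (fun i : 'I_(n + m) => match fintype.split i with inl j => a j | inr j => a' j end).
split; first by move=> i; case: fintype.split.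
rewrite big_split_ord scaler_sumr /=; congr (_ + _); apply: eq_bigr => i _.
  by rewrite (unsplitK (inl i)) scalerA.
by rewrite (unsplitK (inr i)).
Qed.

HB.instance Definition _ (A : set V) :=
  GRing.isSubmodClosed.Build K V (span_pred A) (span_submod_closed A).

End AlgebraicDual.

Section LipschitzTensor.
Context (R : realType) (k : scalar_kind).
Local Notation K := (scalars R k).
Context (X : metricType R) (x0 : X) (E : normedModType K).
Local Notation d := (@mdist R X).
Local Notation lip0E := (lip0_dual x0 E).

Definition boxtimes_fun (x y : X) (e : E) : lip0E -> K^o :=
  fun f => (f x - f y) e.

Lemma boxtimes_subproof x y e : boxtimes_fun x y e \in @algdual_pred K lip0E.
Proof.
apply/asboolP => a f g; rewrite /boxtimes_fun /= !fctE.
by rewrite opprD addrACA -scalerBr.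
Qed.

Definition boxtimes (x y : X) (e : E) : algdual lip0E :=
  AlgDual (boxtimes_subproof x y e).

Definition boxtimes_set : set (algdual lip0E) :=
  [set u | exists x y e, u = boxtimes x y e].

Record ltensor := LTensor {
  ltensor_val :> algdual lip0E ;
  ltensor_valP : ltensor_val \in span_pred boxtimes_set }.
HB.instance Definition _ := [isSub for ltensor_val].
HB.instance Definition _ := [Choice of ltensor by <:].
HB.instance Definition _ := [SubChoice_isSubLmodule of ltensor by <:].

Lemma delta_subproof x y e : boxtimes x y e \in span_pred boxtimes_set.
Proof.
apply/asboolP; exists 1%N, (fun=> 1), (fun=> boxtimes x y e).
by split=> [_|]; [exists x, y, e | rewrite big_ord1 scale1r].
Qed.

Definition delta (x y : X) (e : E) : ltensor :=
  LTensor (delta_subproof x y e).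

Definition delta_sum n (x y : 'I_n -> X) (e : 'I_n -> E) : ltensor :=
  \sum_(i < n) delta (x i) (y i) (e i).

(* X^# is the set of scalar functions [g] such that [is_lipsharp g]. *)
Definition is_lipsharp (g : X -> K^o) : Prop :=
  is_lip0 d (@rdist R k K^o) x0 0 g.

Definition lipsharp_norm (g : X -> K^o) : R := Lip d (@rdist R k K^o) g.

Definition pairing n (g : X -> K^o) (phi : E -> K^o)
    (x y : 'I_n -> X) (e : 'I_n -> E) : K :=
  \sum_(i < n) ((g (x i) - g (y i)) * phi (e i)).

Definition eps_values n (x y : 'I_n -> X) (e : 'I_n -> E) : set R :=
  [set r | exists (g : X -> K^o) (phi : dual E),
    [/\ is_lipsharp g, lipsharp_norm g <= 1, opnorm phi <= 1 &
        r = rnorm (pairing g phi x y e : K^o)]].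

(* The values are collected over all representations of [u]; by [lip_injE]
   below, any single representation gives the same supremum. *)
Definition lip_inj (u : ltensor) : R :=
  sup [set r | exists n (x y : 'I_n -> X) (e : 'I_n -> E),
    u = delta_sum x y e /\ eps_values x y e r].

Definition is_norm (alpha : ltensor -> R) : Prop :=
  [/\ forall u, 0 <= alpha u,
      forall u, alpha u = 0 -> u = 0,
      forall (a : K) u, alpha (a *: u) = rnorm (a : K^o) * alpha u &
      forall u v, alpha (u + v) <= alpha u + alpha v].

Definition lip_crossnorm (alpha : ltensor -> R) : Prop :=
  is_norm alpha /\
  forall x y (e : E), alpha (delta x y e) = d x y * rnorm e.

Definition dualizable (alpha : ltensor -> R) : Prop :=
  forall (g : X -> K^o) (phi : dual E), is_lipsharp g ->
  forall n (x y : 'I_n -> X) (e : 'I_n -> E),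
    rnorm (pairing g phi x y e : K^o) <=
      lipsharp_norm g * opnorm phi * alpha (delta_sum x y e).

Definition uniform_norm (alpha : ltensor -> R) : Prop :=
  forall (h : X -> X) (T : {linear E -> E}),
  is_lip0 d d x0 x0 h -> bounded_operator T ->
  forall n (x y : 'I_n -> X) (e : 'I_n -> E),
    alpha (delta_sum (h \o x) (h \o y) (T \o e)) <=
      Lip d d h * opnorm T * alpha (delta_sum x y e).

End LipschitzTensor.

Section Independence.
Context (R : realType) (k : scalar_kind).
Local Notation K := (scalars R k).
Context (X : metricType R) (x0 : X) (E : normedModType K).
Local Notation d := (@mdist R X).

Lemma scale_lip0_subproof (g : X -> K^o) (phi : dual E) : is_lipsharp x0 g ->
  (fun x => (g x : K) *: phi) \in lip0_dual_pred x0 (E := E).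
Proof.
move=> [g0 [c [c0 cg]]]; apply/asboolP; split; first by rewrite g0 scale0r.
have op0 : 0 <= opnorm phi.
  apply: le_trans (opnorm_ub (v := 0) (dual_bounded phi) _).
    exact: rnorm_ge0.
  by rewrite rnorm0.
exists (c * opnorm phi); split; first exact: mulr_ge0.
move=> x y; rewrite /dual_dist -scalerBl.
have -> : \val ((g x - g y : K) *: phi) = (g x - g y : K) *: \val phi + 0 :> (E -> K^o).
  by rewrite addr0.
have b0 : bounded_operator (0 : E -> K^o).
  by exists 0 => v; rewrite mul0r rnorm0.
apply: (le_trans (opnorm_lin _ (dual_bounded _) b0)).
rewrite opnorm0 addr0 mulrAC ler_wpM2r//; exact: cg.
Qed.

Lemma scale1_ltensor (c : K) (x y : X) (e : E) :
  c *: boxtimes x0 x y e = boxtimes x0 x y (c *: e).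
Proof.
apply/val_inj/funext => f; rewrite /= /boxtimes_fun.
change (c *: (f x - f y) e = (f x - f y) (c *: e)).
case: (f x - f y) => phi /= /asboolP[lphi _].
have phi0 : phi 0 = 0.
  by have := lphi (-1) 0 0; rewrite scaler0 addr0 scaleN1r addNr.
by have := lphi c e 0; rewrite !addr0 phi0 addr0 => ->.
Qed.

Lemma delta_sum_val n (x y : 'I_n -> X) (e : 'I_n -> E) :
  \val (delta_sum x0 x y e) = \sum_(i < n) boxtimes x0 (x i) (y i) (e i).
Proof. by rewrite /delta_sum raddf_sum. Qed.

Lemma ltensor_repr (u : ltensor x0 E) :
  exists n (x y : 'I_n -> X) (e : 'I_n -> E), u = delta_sum x0 x y e.
Proof.
case: u => u u_span; have /asboolP[n [c [a [Aa ua]]]] := u_span.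
pose w i := cid (Aa i).
pose w2 i := cid (projT2 (w i)).
pose w3 i := cid (projT2 (w2 i)).
exists n, (fun i => projT1 (w i)), (fun i => projT1 (w2 i)).
exists (fun i => c i *: projT1 (w3 i)); apply: val_inj.
rewrite delta_sum_val [LHS]ua; apply: eq_bigr => i _.
by rewrite -scale1_ltensor -(projT2 (w3 i)).
Qed.

Lemma delta_sum_pairing (g : X -> K^o) (phi : dual E)
    (hg : is_lipsharp x0 g) n (x y : 'I_n -> X) (e : 'I_n -> E) :
  delta_sum x0 x y e (Lip0Dual (scale_lip0_subproof phi hg)) =
  pairing g phi x y e.
Proof.
rewrite delta_sum_val /pairing.
have -> : forall f, \val (\sum_(i < n) boxtimes x0 (x i) (y i) (e i)) f =
    \sum_(i < n) boxtimes x0 (x i) (y i) (e i) f.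
  by move=> f; rewrite raddf_sum fct_sumE.
by apply: eq_bigr => i _; rewrite /= /boxtimes_fun /= -scalerBl.
Qed.

Lemma lip_injE n (x y : 'I_n -> X) (e : 'I_n -> E) :
  lip_inj (delta_sum x0 x y e) = sup (eps_values x0 x y e).
Proof.
congr sup; apply/seteqP; split => [r|r rxy]; last by exists n, x, y, e.
move=> [m [x' [y' [e' [eq_u [g [phi [hg g1 phi1 ->]]]]]]]].
exists g, phi; split=> //; congr rnorm.
by rewrite -(delta_sum_pairing phi hg) -eq_u delta_sum_pairing.
Qed.

End Independence.

(* Main.v *)
Require Import Defs.
From HB Require Import structures.
From mathcomp Require Import all_boot all_order all_algebra.
From mathcomp Require Import complex ring lra.
From mathcomp Require Import all_classical all_reals all_analysis.
Set Implicit Arguments.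
Unset Strict Implicit.
Unset Printing Implicit Defensive.
Import Order.TTheory GRing.Theory Num.Theory.
Import numFieldNormedType.Exports.
Local Open Scope classical_set_scope.
Local Open Scope ring_scope.

(** A Lipschitz function [g] and a functional [phi] combine into the rank-one
map [x |-> g x *: phi] from [X] to the dual of [E], and the number
[sum_i (g x_i - g y_i) * phi e_i] is the value at this map of the functional
that represents the tensor.  So the injective norm of [u] is the supremum of
[|u f|] over the rank-one maps [f] with both factors in the unit balls
([lip_inj_evalE]).  In this form homogeneity, the triangle inequality and
dualizability only use that [u f] is linear in [u], in [g] and in [phi].

Uniformity follows from dualizability: testing the transformed tensor on
[(g, phi)] amounts to testing the original one on [g \o h] and [phi \o T],
whose norms are at most [Lip h] and [opnorm T].

Two facts need an argument of another kind.

Definiteness ([rank1_separating]): a tensor only sees the values of a map at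
the finitely many points of a representation.  A Lipschitz bump that is 1 at
one of these points and 0 at the others, times the value of [f] at that point,
is a rank-one map; subtracting it from [f] removes the point, so that by
induction a tensor that vanishes on rank-one maps vanishes on every [f].

The lower bound in the cross-norm identity ([lip_inj_delta]): the function
[d(., y) - d(x0, y)] is 1-Lipschitz and attains [d(x, y)] on the pair, so what
is missing is a functional of norm at most 1 attaining [|e|] at [e].  It is
given by the Hahn-Banach theorem ([hahn_banach]), applied to the norm over the
reals; over the complex numbers one uses the functional whose real part is the
real-linear one ([real_part_extension]). *)

(** * The Hahn-Banach theorem for sublinear functionals *)

Section HahnBanach.
Context (R : realType) (V : lmodType R).
Implicit Types (p q : V -> R) (e x y : V).

(** Over the reals, inequality in the second clause already forces the usual
positive homogeneity, and it passes to infima. *)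
Definition sublinear p :=
  (forall x y, p (x + y) <= p x + p y) /\
  (forall t x, 0 <= t -> p (t *: x) <= t * p x).

(** For nonzero [t], the reverse inequality is the assumed one at [t^-1] and
[t *: x]. *)
Lemma sublinearZ p t x : sublinear p -> 0 <= t -> p (t *: x) = t * p x.
Proof.
move=> [pD pZ] t0; have p00 : p 0 = 0.
  have := pZ 0 0 (lexx _); have := pD 0 0.
  by rewrite addr0 scaler0 mul0r; lra.
case: (eqVneq t 0) => [->|tN0]; first by rewrite scale0r mul0r.
apply/eqP; rewrite eq_le pZ//= -ler_pdivlMl; last first.
  by rewrite lt_neqAle eq_sym tN0.
by rewrite -[in leLHS](scalerK tN0 x) pZ// invr_ge0.
Qed.

Lemma sublinear0 p : sublinear p -> p 0 = 0.
Proof. by move=> sp; rewrite -(scale0r 0) (sublinearZ _ sp)// mul0r. Qed.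

Lemma sublinearN_ge p x : sublinear p -> - p (- x) <= p x.
Proof.
by move=> sp; have := (proj1 sp) x (- x); rewrite subrr sublinear0//; lra.
Qed.

(** The slide of [p] along [e] is a sublinear functional below [p] whose value
at [- e] is at most [- p e].  Any linear functional below it therefore takes
the value [p e] at [e]; and if [p] itself is minimal, it equals all its
slides, which makes it additive. *)
Definition slide p e x :=
  inf [set p (x + t *: e) - t * p e | t in [set t | 0 <= t]].

(** The values are bounded below because [t * p e = p (t *: e)] is at most
[p (x + t *: e) + p (- x)]. *)
Lemma slide_le p e x t : sublinear p -> 0 <= t ->
  slide p e x <= p (x + t *: e) - t * p e.
Proof.
move=> sp t0; apply: ge_inf; last by exists t.
exists (- p (- x)) => _ [s /= s0 <-].
have := (proj1 sp) (x + s *: e) (- x).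
by rewrite addrAC subrr add0r (sublinearZ _ sp)//; lra.
Qed.

Lemma le_slide p e x c :
  (forall t, 0 <= t -> c <= p (x + t *: e) - t * p e) -> c <= slide p e x.
Proof.
move=> cp; apply: lb_le_inf; last by move=> _ [t /= t0 <-]; exact: cp.
by exists (p (x + 0 *: e) - 0 * p e), 0 => /=.
Qed.

Lemma slide_sublinear p e : sublinear p -> sublinear (slide p e).
Proof.
move=> sp; split => [x y|a x a0].
  rewrite -lerBlDl; apply: le_slide => t t0.
  rewrite lerBlDl -lerBlDr; apply: le_slide => s s0.
  have := slide_le e (x + y) sp (addr_ge0 s0 t0).
  have := (proj1 sp) (x + s *: e) (y + t *: e).
  by rewrite addrACA -scalerDl; lra.
case: (eqVneq a 0) => [->|aN0].
  have := slide_le e 0 sp (lexx 0).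
  by rewrite !scale0r mul0r addr0 (sublinear0 sp) mul0r subr0.
have {aN0} a_gt0 : 0 < a by rewrite lt_neqAle eq_sym aN0.
rewrite -ler_pdivrMl//; apply: le_slide => t t0.
rewrite ler_pdivrMl// mulrBr mulrA -(sublinearZ (x + _) sp a0) scalerDr scalerA.
by apply: slide_le => //; exact: mulr_ge0.
Qed.

Lemma slide_le_id p e x : sublinear p -> slide p e x <= p x.
Proof.
move=> sp; have := slide_le e x sp (lexx 0).
by rewrite scale0r addr0 mul0r subr0.
Qed.

(** Zorn's lemma on total functions: the pointwise infimum of a chain is again
sublinear, and it is finite because [- p (- x)] bounds every minorant of [p]
from below at [x]. *)
Lemma minimal_sublinear p : sublinear p -> exists q,
  [/\ sublinear q, forall x, q x <= p x &
   forall r, sublinear r -> (forall x, r x <= q x) -> r = q].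
Proof.
move=> sp; pose T := {q | sublinear q /\ forall x, q x <= p x}.
pose below (s t : T) := `[< forall x, sval t x <= sval s x >].
have belowE s t : below s t <-> forall x, sval t x <= sval s x.
  by split=> /asboolP.
have [|||A totA|[q [sq qp]] qmin] := @Zorn T below.
- by move=> t; apply/belowE.
- move=> r s t /belowE rs /belowE st; apply/belowE => x.
  exact: le_trans (st x) (rs x).
- move=> [s ps] [t pt] /belowE/= st /belowE/= ts; apply: eq_exist.
  by apply/funext => x; apply/eqP; rewrite eq_le st ts.
- have [[a Aa]|A0] := pselect (A !=set0); last first.
    exists (exist _ p (conj sp (fun=> lexx _))) => s As.
    by exfalso; apply: A0; exists s.
  pose m x := inf [set sval s x | s in A].
  have m_le s x : A s -> m x <= sval s x.
    move=> As; apply: ge_inf; last by exists s.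
    exists (- p (- x)) => _ [[r [sr rp]] Ar <-] /=.
    by apply: le_trans (sublinearN_ge x sr); rewrite lerN2.
  have le_m c x : (forall s, A s -> c <= sval s x) -> c <= m x.
    move=> cA; apply: lb_le_inf; first by exists (sval a x), a.
    by move=> _ [s As <-]; exact: cA.
  have sm : sublinear m.
    split=> [x y|t x t0].
      rewrite -lerBlDl; apply: (le_m) => s As.
      rewrite lerBlDl -lerBlDr; apply: (le_m) => r Ar.
      (* In a chain the smaller of [r] and [s] bounds both terms. *)
      have [u [Au ux uy]] : exists u,
          [/\ A u, sval u x <= sval r x & sval u y <= sval s y].
        have [/belowE rs|/belowE sr] := totA r s Ar As.
          by exists s; split.
        by exists r; split.
      have [uD _] := proj1 (svalP u).
      by have := m_le u (x + y) Au; have := uD x y; lra.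
    case: (eqVneq t 0) => [->|tN0].
      have [sa _] := svalP a.
      rewrite scale0r mul0r; apply: (le_trans (m_le a 0 Aa)).
      by rewrite sublinear0.
    have t_gt0 : 0 < t by rewrite lt_neqAle eq_sym tN0.
    rewrite -ler_pdivrMl//; apply: (le_m) => s As; rewrite ler_pdivrMl//.
    apply: (le_trans (m_le s _ As)).
    by have [[_ sZ] _] := svalP s; exact: sZ.
  have mp x : m x <= p x.
    by apply: le_trans (m_le a x Aa) _; have [_] := svalP a.
  by exists (exist _ m (conj sm mp)) => s As; apply/belowE => x; exact: m_le.
exists q; split=> // r sr rq.
have rp x : r x <= p x by exact: le_trans (rq x) (qp x).
have /qmin/(congr1 sval) :
    below (exist _ q (conj sq qp)) (exist _ r (conj sr rp)).
  exact/belowE.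
by [].
Qed.

(** A minimal sublinear functional is linear, and a minimal one below the slide
of [p] along [e] attains [p e] at [e]. *)
Theorem hahn_banach p e : sublinear p ->
  exists f : V -> R, [/\ forall a x y, f (a *: x + y) = a * f x + f y,
    forall x, f x <= p x & f e = p e].
Proof.
move=> sp; have ssp := slide_sublinear e sp.
have [f [sf f_le f_min]] := minimal_sublinear ssp.
have fD x y : f (x + y) = f x + f y.
  apply/eqP; rewrite eq_le (proj1 sf)/=.
  have slide_f : slide f y = f.
    apply: f_min; first exact: slide_sublinear.
    by move=> z; exact: slide_le_id.
  by have := slide_le y x sf (@ler01 R); rewrite slide_f scale1r mul1r; lra.
have fN x : f (- x) = - f x.
  by apply/eqP; rewrite -addr_eq0 addrC -fD subrr sublinear0.
have f_lep x : f x <= p x by exact: le_trans (f_le x) (slide_le_id _ _ sp).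
exists f; split=> //.
  move=> a x y; rewrite fD; congr (_ + _).
  have [a0|/ltW a0] := leP 0 a; first exact: sublinearZ.
  by rewrite -[a]opprK scaleNr fN (sublinearZ _ sf) ?oppr_ge0// !mulNr.
apply/eqP; rewrite eq_le f_lep/=.
have := le_trans (f_le (- e)) (slide_le e (- e) sp (@ler01 R)).
by rewrite scale1r addNr (sublinear0 sp) fN; lra.
Qed.

End HahnBanach.

(** * Real and complex scalars *)

Section LinearMaps.
Context (K : pzRingType) (V W : lmodType K) (T : V -> W).

Lemma linear_fun0 : linear T -> T 0 = 0.
Proof.
by move=> linT; have := linT (-1) 0 0; rewrite scaler0 addr0 scaleN1r addNr.
Qed.

Lemma linear_funZ a v : linear T -> T (a *: v) = a *: T v.
Proof.
by move=> linT; have := linT a v 0; rewrite linear_fun0// !addr0.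
Qed.

End LinearMaps.

Lemma rnorm_complex (R : realType) (z : R[i]) :
  @rnorm R ComplexScalars (scalars R ComplexScalars)^o z =
  Num.sqrt (complex.Re z ^+ 2 + complex.Im z ^+ 2).
Proof.
case: z => x y.
change (complex.Re `|(x +i* y)%C| = Num.sqrt (x ^+ 2 + y ^+ 2)).
by rewrite normc_def.
Qed.

Section RealScalarsInside.
Context (R : realType) (k : scalar_kind).
Local Notation K := (scalars R k).

Definition of_real : R -> scalars R k :=
  match k with RealScalars => id | ComplexScalars => real_complex R end.

Lemma of_realB r s : of_real (r - s) = of_real r - of_real s.
Proof. by rewrite /of_real; case: k => //=; rewrite rmorphB. Qed.

Lemma of_realD r s : of_real (r + s) = of_real r + of_real s.
Proof. by rewrite /of_real; case: k => //=; rewrite rmorphD. Qed.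

Lemma of_realM r s : of_real (r * s) = of_real r * of_real s.
Proof. by rewrite /of_real; case: k => //=; rewrite rmorphM. Qed.

Lemma of_real0 : of_real 0 = 0.
Proof. by rewrite /of_real; case: k => //=; rewrite rmorph0. Qed.

Lemma of_real1 : of_real 1 = 1.
Proof. by rewrite /of_real; case: k => //=; rewrite rmorph1. Qed.

Lemma ler_of_real r s : (of_real r <= of_real s) = (r <= s).
Proof. by rewrite /of_real; case: k => //=; rewrite lecR. Qed.

Lemma of_real_real r : of_real r \is Num.real.
Proof. by rewrite realE -of_real0 !ler_of_real le_total. Qed.

Lemma ge0_rpartK (a : K) : 0 <= a -> of_real (rpart a) = a.
Proof.
rewrite /of_real /rpart; case: k a => //= -[ar ai].
by rewrite lecE /= => /andP[/eqP -> _].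
Qed.

Lemma normE_rnorm (V : normedModType K) (v : V) : `|v| = of_real (rnorm v).
Proof. by rewrite ge0_rpartK. Qed.

Lemma rnorm_of_real r : rnorm (of_real r : K^o) = `|r|.
Proof.
rewrite /of_real; case: k => //.
by rewrite [LHS]rnorm_complex/= expr0n/= addr0 sqrtr_sqr.
Qed.

Lemma rnormM (a b : K) :
  rnorm (a * b : K^o) = rnorm (a : K^o) * rnorm (b : K^o).
Proof. exact: (rnormZ a (b : K^o)). Qed.

Lemma rpart_le_rnorm (a : K) : rpart a <= rnorm (a : K^o).
Proof.
case: k a => [a|[ar ai]]; first exact: ler_norm.
rewrite [leRHS]rnorm_complex/= (le_trans (ler_norm _))//.
by rewrite -sqrtr_sqr ler_wsqrtr// lerDl sqr_ge0.
Qed.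

(** The multiplier is the conjugate of [z]; multiplying by it turns a bound on
real parts into a bound on absolute values. *)
Lemma conj_scalar (z : K) : exists a : K,
  rnorm (a : K^o) = rnorm (z : K^o) /\ rpart (a * z) = rnorm (z : K^o) ^+ 2.
Proof.
case: k z => [z|[x y]].
  by exists z; split=> //; rewrite -expr2 -[LHS]real_normK ?num_real.
exists (x -i* y)%C; split.
  by rewrite [LHS]rnorm_complex [RHS]rnorm_complex/= sqrrN.
rewrite [X in _ = X ^+ 2]rnorm_complex/=.
by rewrite sqr_sqrtr ?addr_ge0 ?sqr_ge0//; ring.
Qed.

Lemma bounded_linear_cts (V W : normedModType K) (T : V -> W) :
  linear T -> bounded_operator T -> continuous T.
Proof.
move=> linT [c cT].
pose f : {linear V -> W} := HB.pack T (GRing.isLinear.Build K V W *:%R T linT).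
apply: (@bounded_linear_continuous K V W f).
apply/linear_boundedP; near=> r => x.
apply: (@le_trans _ _ (of_real c * `|x|)).
  by rewrite !normE_rnorm -of_realM ler_of_real.
by rewrite ler_wpM2r//; near: r; apply: nbhs_pinfty_ge; exact: of_real_real.
Unshelve. all: by end_near. Qed.

End RealScalarsInside.

(** * Norming functionals *)

Section Realification.
Context (R : realType) (k : scalar_kind).
Local Notation K := (scalars R k).

(** A copy of the carrier, so that it can bear the real module structure next to
the given one. *)
Definition realification (E : normedModType K) : Type := E.

Variable E : normedModType K.

HB.instance Definition _ := GRing.Zmodule.copy (realification E) E.

Let rscale (r : R) (v : realification E) : realification E :=
  of_real k r *: (v : E).

Let rscaleA a b v : rscale a (rscale b v) = rscale (a * b) v.
Proof. by rewrite /rscale scalerA of_realM. Qed.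

Let rscale1 : left_id 1 rscale.
Proof. by move=> v; rewrite /rscale of_real1 scale1r. Qed.

Let rscaleDr : right_distributive rscale +%R.
Proof. by move=> a v w; rewrite /rscale scalerDr. Qed.

Let rscaleDl v : {morph rscale^~ v : a b / a + b}.
Proof. by move=> a b; rewrite /rscale of_realD scalerDl. Qed.

HB.instance Definition _ := GRing.Zmodule_isLmodule.Build R (realification E)
  rscaleA rscale1 rscaleDr rscaleDl.

Lemma realificationZ r (v : E) : r *: (v : realification E) = of_real k r *: v.
Proof. by []. Qed.

Lemma rnorm_sublinear : sublinear (V := realification E) (@rnorm R k E).
Proof.
split=> [|t x t0]; first exact: rnormD.
by rewrite realificationZ rnormZ rnorm_of_real ger0_norm.
Qed.

End Realification.

(** In the complex case the functional is [x |-> L x - i L (i x)], the only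
complex-linear one with real part [L]. *)
Lemma real_part_extension (R : realType) (k : scalar_kind)
    (E : normedModType (scalars R k)) (L : E -> R) :
  (forall (a : R) x y, L (of_real k a *: x + y) = a * L x + L y) ->
  exists phi : E -> (scalars R k)^o,
    linear phi /\ forall x, rpart (phi x) = L x.
Proof.
case: k E L => E L linL; first by exists L.
have LD x y : L (x + y) = L x + L y.
  by have := linL 1 x y; rewrite of_real1 scale1r mul1r.
have L0 : L 0 = 0 by have := LD 0 0; rewrite addr0; lra.
have LZ a x : L (real_complex R a *: x) = a * L x.
  by have := linL a x 0; rewrite L0 !addr0.
pose i : scalars R ComplexScalars := 'i%C.
have Lbc b c v : L ((b +i* c : scalars R ComplexScalars)%C *: v) =
    b * L v + c * L (i *: v).
  rewrite -!LZ -LD scalerA -scalerDl; congr (L (_ *: v)).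
  by apply/eqP; rewrite eq_complex /=; apply/andP; split; apply/eqP; ring.
have Li b c v : L (i *: ((b +i* c : scalars R ComplexScalars)%C *: v)) =
    b * L (i *: v) - c * L v.
  rewrite scalerA (_ : _ * _ = (- c +i* b : scalars R ComplexScalars)%C).
    by rewrite Lbc; ring.
  by apply/eqP; rewrite eq_complex /=; apply/andP; split; apply/eqP; ring.
exists (fun x => L x +i* - L (i *: x))%C; split=> // -[b c] x y.
rewrite scalerDr !LD Lbc Li.
by apply/eqP; rewrite eq_complex /=; apply/andP; split; apply/eqP; ring.
Qed.

(** The real-linear [L] given by Hahn-Banach is below the norm and attains it at
[e].  For [a] conjugate to [phi v], linearity gives
[|phi v|^2 = L (a *: v) <= |phi v| |v|], hence the bound on [phi]. *)
Lemma norming_functional (R : realType) (k : scalar_kind)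
    (E : normedModType (scalars R k)) (e : E) :
  exists phi : dual E, opnorm phi <= 1 /\ rnorm e <= rnorm (phi e).
Proof.
have [L [linL L_le Le]] :=
  hahn_banach (e : realification E) (rnorm_sublinear E).
have [phi [linphi phiL]] := real_part_extension linL.
have phi_le v : rnorm (phi v) <= rnorm v.
  have [a [na az]] := conj_scalar (phi v).
  have := L_le (a *: v); rewrite -phiL (linear_funZ _ _ linphi).
  rewrite [rpart _]az rnormZ na expr2.
  have [->|n0] := eqVneq (rnorm (phi v)) 0; first by rewrite rnorm_ge0.
  by rewrite ler_pM2l// lt_neqAle eq_sym n0 rnorm_ge0.
have phiP : phi \in @dual_pred R k E.
  apply/asboolP; split=> //; apply: bounded_linear_cts => //.
  by exists 1 => v; rewrite mul1r.
exists (Dual phiP); split.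
  by apply: opnorm_le => v; exact: le_trans (phi_le v).
by rewrite -Le -phiL; exact: rpart_le_rnorm.
Qed.

(** * Operator norms and Lipschitz constants *)

Section Operators.
Context (R : realType) (k : scalar_kind).
Local Notation K := (scalars R k).

Lemma opnorm_ge0 (V W : normedModType K) (T : V -> W) :
  bounded_operator T -> 0 <= opnorm T.
Proof.
move=> bT; apply: le_trans (opnorm_ub (v := 0) bT _); first exact: rnorm_ge0.
by rewrite rnorm0.
Qed.

Lemma opnormP (V W : normedModType K) (T : V -> W) v :
  linear T -> bounded_operator T -> rnorm (T v) <= opnorm T * rnorm v.
Proof.
move=> linT bT.
have [v0|v0] := eqVneq (rnorm v) 0.
  by rewrite (rnorm_eq0 v0) linear_fun0// !rnorm0 mulr0.
have v_gt0 : 0 < rnorm v by rewrite lt_neqAle eq_sym v0 rnorm_ge0.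
rewrite -ler_pdivrMr// mulrC.
have := opnorm_ub (v := of_real k (rnorm v)^-1 *: v) bT.
rewrite (linear_funZ _ _ linT) !rnormZ rnorm_of_real.
by rewrite ger0_norm ?invr_ge0 ?rnorm_ge0// mulVf// => ->.
Qed.

Variable E : normedModType K.

Lemma dual_linear (phi : dual E) : linear phi.
Proof. by case: phi => phi /= /asboolP[]. Qed.

Lemma dual_le (phi : dual E) v : rnorm (phi v) <= opnorm phi * rnorm v.
Proof. by apply: opnormP; [exact: dual_linear|exact: dual_bounded]. Qed.

Lemma opnorm_scale (a : K) (phi : dual E) :
  opnorm (a *: phi : dual E) <= rnorm (a : K^o) * opnorm phi.
Proof.
apply: opnorm_le => v v1.
rewrite [X in rnorm X](_ : _ = a *: phi v)// rnormZ ler_wpM2l ?rnorm_ge0//.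
exact: opnorm_ub (dual_bounded _) _.
Qed.

Lemma dual_comp (T : {linear E -> E}) (phi : dual E) : bounded_operator T ->
  exists psi : dual E, psi =1 phi \o T /\ opnorm psi <= opnorm T * opnorm phi.
Proof.
move=> bT.
have le_phiT v : rnorm (phi (T v)) <= opnorm T * opnorm phi * rnorm v.
  apply: le_trans (dual_le _ _) _.
  rewrite [opnorm T * _]mulrC -mulrA ler_wpM2l//.
    exact: opnorm_ge0 (dual_bounded _).
  by apply: opnormP => //; exact: linearP.
have psiP : (phi \o T : E -> K^o) \in @dual_pred R k E.
  have lin : linear (phi \o T : E -> K^o).
    by move=> a v w /=; rewrite linearP dual_linear.
  apply/asboolP; split=> //; apply: bounded_linear_cts => //.
  by exists (opnorm T * opnorm phi).
exists (Dual psiP); split=> //; apply: opnorm_le => v v1.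
apply: le_trans (le_phiT v) _; rewrite ler_piMr//.
by rewrite mulr_ge0// opnorm_ge0//; exact: dual_bounded.
Qed.

End Operators.

Section LeastLipschitzConstant.
Context (R : realType) (X Y : Type) (dX : X -> X -> R) (dY : Y -> Y -> R).
Implicit Types f : X -> Y.

Lemma Lip_le f c : 0 <= c -> (forall x y, dY (f x) (f y) <= c * dX x y) ->
  Lip dX dY f <= c.
Proof. by move=> c0 fc; apply: ge_inf => //; exists 0 => r []. Qed.

Lemma Lip_ge0 f : 0 <= Lip dX dY f.
Proof.
have [ne|] := pselect (lip_consts dX dY f !=set0).
  by apply: lb_le_inf => // r [].
by move=> /set0P/negP/negPn/eqP e; rewrite /Lip e inf0.
Qed.

(** The infimum that defines the least constant is attained. *)
Lemma LipP f x y : (forall x y, 0 <= dX x y) -> lip_consts dX dY f !=set0 ->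
  dY (f x) (f y) <= Lip dX dY f * dX x y.
Proof.
move=> dX0 ne; have [d0|dN0] := eqVneq (dX x y) 0.
  by case: ne => c [_ /(_ x y)]; rewrite d0 !mulr0.
have d_gt0 : 0 < dX x y by rewrite lt_neqAle eq_sym dN0 dX0.
rewrite -ler_pdivrMr//; apply: lb_le_inf => // c [_ fc].
by rewrite ler_pdivrMr.
Qed.

End LeastLipschitzConstant.

(** * Scalar Lipschitz functions *)

Section LipschitzFunctions.
Context (R : realType) (k : scalar_kind) (X : metricType R) (x0 : X).
Local Notation K := (scalars R k).
Local Notation d := (@mdist R X).

Lemma lipsharpP (g : X -> K^o) x y : is_lipsharp x0 g ->
  rnorm (g x - g y) <= lipsharp_norm g * d x y.
Proof.
move=> [_ ne].
by apply: (LipP (dY := @rdist R k K^o)) => // *; exact: mdist_ge0.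
Qed.

Lemma lipsharp_of_real (g : X -> R) c : 0 <= c -> g x0 = 0 ->
  (forall x y, g x - g y <= c * d x y) ->
  is_lipsharp x0 (of_real k \o g : X -> K^o) /\
  lipsharp_norm (of_real k \o g : X -> K^o) <= c.
Proof.
move=> c0 g0 gc.
have gLip x y : rdist (of_real k (g x) : K^o) (of_real k (g y)) <= c * d x y.
  rewrite /rdist -of_realB rnorm_of_real ler_norml gc andbT.
  by rewrite lerNl opprB metric_sym.
split; last exact: Lip_le.
by split; [rewrite /= g0 of_real0|exists c].
Qed.

Lemma lipsharp_scale (a : K) (g : X -> K^o) : is_lipsharp x0 g ->
  is_lipsharp x0 (fun x => a * g x : K^o) /\
  lipsharp_norm (fun x => a * g x : K^o) <= rnorm (a : K^o) * lipsharp_norm g.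
Proof.
move=> hg; have c0 : 0 <= rnorm (a : K^o) * lipsharp_norm g.
  by rewrite mulr_ge0 ?rnorm_ge0 ?Lip_ge0.
have agLip x y : rdist (a * g x : K^o) (a * g y) <=
    rnorm (a : K^o) * lipsharp_norm g * d x y.
  rewrite /rdist -mulrBr rnormM -mulrA ler_wpM2l ?rnorm_ge0//; exact: lipsharpP.
split; last exact: Lip_le.
split; first by case: hg => -> _; rewrite mulr0.
by exists (rnorm (a : K^o) * lipsharp_norm g).
Qed.

Lemma lipsharp_comp (g : X -> K^o) (h : X -> X) :
  is_lipsharp x0 g -> is_lip0 d d x0 x0 h ->
  is_lipsharp x0 (g \o h) /\
  lipsharp_norm (g \o h) <= Lip d d h * lipsharp_norm g.
Proof.
move=> hg [h0 hne]; have c0 : 0 <= Lip d d h * lipsharp_norm g.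
  by rewrite mulr_ge0 ?Lip_ge0.
have ghLip x y :
    rdist (g (h x)) (g (h y)) <= Lip d d h * lipsharp_norm g * d x y.
  apply: le_trans (lipsharpP _ _ hg) _; rewrite [Lip _ _ _ * _]mulrC -mulrA.
  rewrite ler_wpM2l ?Lip_ge0//.
  by apply: LipP => // *; exact: mdist_ge0.
split; last exact: Lip_le.
by split; [rewrite /= h0; case: hg|exists (Lip d d h * lipsharp_norm g)].
Qed.

(** Subtracting the constant makes the function vanish at the base point. *)
Lemma lipsharp_dist (y : X) :
  let g : X -> K^o := fun x => of_real k (d x y - d x0 y) in
  is_lipsharp x0 g /\ lipsharp_norm g <= 1.
Proof.
apply: (@lipsharp_of_real (fun x => d x y - d x0 y)) => // [|x z].
  by rewrite subrr.
by have := metric_triangle x z y; rewrite mul1r; lra.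
Qed.

Lemma finite_distance_gap (z : X) (S : seq X) : z \notin S ->
  exists2 r : R, 0 < r & forall w, w \in S -> r <= d z w.
Proof.
elim: S => [_|w S IH]; first by exists 1.
rewrite inE negb_or => /andP[zw /IH[r r0 rS]].
exists (Num.min r (d z w)); first by rewrite lt_min r0 mdist_gt0.
move=> v; rewrite inE => /predU1P[->|/rS rv]; first by rewrite ge_min lexx orbT.
by rewrite ge_min rv.
Qed.

(** The cone of height 1 at [z] that reaches 0 at the distance from [z] to [S].
The base point is in [S] since members of the Lipschitz dual vanish there. *)
Lemma lipsharp_bump (z : X) (S : seq X) : z \notin S -> x0 \in S ->
  exists g : X -> K^o,
    [/\ is_lipsharp x0 g, g z = 1 & forall w, w \in S -> g w = 0].
Proof.
move=> /finite_distance_gap[r r0 rS] x0S.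
pose b w : R := Num.max 0 (1 - r^-1 * d z w).
have b0 w : w \in S -> b w = 0.
  by move=> /rS rw; apply/max_idPl; rewrite subr_le0 ler_pdivlMl// mulr1.
have ri0 : 0 <= r^-1 by rewrite invr_ge0 ltW.
have bLip x y : b x - b y <= r^-1 * d x y.
  have := metric_triangle z x y => /(ler_wpM2l ri0); rewrite mulrDr => dxy.
  have := mulr_ge0 ri0 (mdist_ge0 x y); move: dxy.
  rewrite /b; case: (ltP 0 (1 - _ * mdist z x));
    by case: (ltP 0 (1 - _ * mdist z y)); lra.
have [hb _] := lipsharp_of_real ri0 (b0 _ x0S) bLip.
exists (of_real k \o b); split=> // [|w wS]; last by rewrite /= b0 ?of_real0.
by rewrite /= /b mdistxx mulr0 subr0 (max_idPr _) ?ler01// of_real1.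
Qed.

End LipschitzFunctions.

(** * The Lipschitz injective norm *)

Section InjectiveNorm.
Context (R : realType) (k : scalar_kind) (X : metricType R) (x0 : X).
Local Notation K := (scalars R k).
Local Notation d := (@mdist R X).
Context (E : normedModType K).
Implicit Types (u v : ltensor x0 E) (f : lip0_dual x0 E) (phi : dual E).

Definition rank1 (g : X -> K^o) (hg : is_lipsharp x0 g) phi : lip0_dual x0 E :=
  Lip0Dual (scale_lip0_subproof phi hg).

Lemma ltensor_linear u : linear u.
Proof. by have /asboolP := algdual_valP (ltensor_val u). Qed.

Lemma ltensor_evalD u v f : (u + v) f = u f + v f. Proof. by []. Qed.

Lemma ltensor_evalZ (a : K) u f : (a *: u) f = a * u f. Proof. by []. Qed.

Lemma delta_sum_eval n (x y : 'I_n -> X) (e : 'I_n -> E) f :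
  delta_sum x0 x y e f = \sum_(i < n) (f (x i) - f (y i)) (e i).
Proof.
rewrite delta_sum_val.
by apply: (big_rec2 (fun (u : algdual _) (b : K) => u f = b)) => // i a b _ <-.
Qed.

(** The constant is the cost [sum_i d(x_i, y_i) |e_i|] of a representation of
[u]; this bound makes the supremum below finite. *)
Lemma ltensor_bounded u : exists2 C : R, 0 <= C &
  forall g (hg : is_lipsharp x0 g) phi,
    rnorm (u (rank1 hg phi) : K^o) <= C * (lipsharp_norm g * opnorm phi).
Proof.
have [n [x [y [e ->]]]] := ltensor_repr u.
exists (\sum_(i < n) d (x i) (y i) * rnorm (e i)).
  by apply: sumr_ge0 => i _; rewrite mulr_ge0 ?mdist_ge0 ?rnorm_ge0.
move=> g hg phi; rewrite delta_sum_pairing mulr_suml.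
pose S := fun (a : K^o) (b : R) => rnorm a <= b.
apply: (big_rec2 S) => [|i a b _ ab]; first by rewrite /S rnorm0.
apply: (le_trans (rnormD _ _)); rewrite lerD// rnormM.
rewrite [leRHS]mulrACA [d _ _ * _]mulrC [rnorm (e i) * _]mulrC.
apply: ler_pM; [exact: rnorm_ge0|exact: rnorm_ge0| |exact: dual_le].
exact: (lipsharpP _ _ hg).
Qed.

(** Without reference to a representation of [u], the norm becomes a supremum of
absolute values of linear functions of [u]. *)
Lemma lip_inj_evalE u : lip_inj u =
  sup [set r | exists g (hg : is_lipsharp x0 g) phi,
    [/\ lipsharp_norm g <= 1, opnorm phi <= 1 &
        r = rnorm (u (rank1 hg phi) : K^o)]].
Proof.
have [n [x [y [e ->]]]] := ltensor_repr u.
rewrite lip_injE; congr sup; apply/seteqP; split => r.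
  move=> [g [phi [hg g1 phi1 ->]]]; exists g, hg, phi.
  by rewrite delta_sum_pairing.
move=> [g [hg [phi [g1 phi1 ->]]]]; exists g, phi.
by rewrite delta_sum_pairing.
Qed.

Lemma lipsharp0 : is_lipsharp x0 (fun=> 0 : K^o) /\
  lipsharp_norm ((fun=> 0) : X -> K^o) <= 1.
Proof.
have [] := @lipsharp_of_real R k X x0 (fun=> 0) 1 ler01 erefl.
  by move=> x y; rewrite subrr mul1r mdist_ge0.
by rewrite /comp of_real0.
Qed.

Lemma lip_inj_le u c :
  (forall g (hg : is_lipsharp x0 g) phi,
    lipsharp_norm g <= 1 -> opnorm phi <= 1 ->
    rnorm (u (rank1 hg phi) : K^o) <= c) ->
  lip_inj u <= c.
Proof.
move=> uc; rewrite lip_inj_evalE; apply: ge_sup; last first.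
  by move=> _ [g [hg [phi [g1 phi1 ->]]]]; exact: uc.
have [h0 h01] := lipsharp0.
exists (rnorm (u (rank1 h0 0) : K^o)), (fun=> 0), h0, 0; split=> //.
by rewrite opnorm0 ler01.
Qed.

Lemma lip_inj_ub u g (hg : is_lipsharp x0 g) phi :
  lipsharp_norm g <= 1 -> opnorm phi <= 1 ->
  rnorm (u (rank1 hg phi) : K^o) <= lip_inj u.
Proof.
move=> g1 phi1; rewrite lip_inj_evalE.
apply: ub_le_sup; last by exists g, hg, phi.
have [C C0 uC] := ltensor_bounded u.
exists C => _ [g' [hg' [psi [g'1 psi1 ->]]]].
apply: (le_trans (uC _ _ _)); rewrite ler_piMr// mulr_ile1 ?Lip_ge0//.
exact: opnorm_ge0 (dual_bounded _).
Qed.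

Lemma lip_inj_ge0 u : 0 <= lip_inj u.
Proof.
have [h0 h01] := lipsharp0.
apply: le_trans (lip_inj_ub u h0 (phi := 0) h01 _).
  exact: rnorm_ge0.
by rewrite opnorm0.
Qed.

(** Normalise both factors; when one of them has norm zero there is nothing to
normalise, and [ltensor_bounded] shows that the value itself is zero. *)
Lemma lip_inj_dual u g (hg : is_lipsharp x0 g) phi :
  rnorm (u (rank1 hg phi) : K^o) <= lipsharp_norm g * opnorm phi * lip_inj u.
Proof.
have [C C0 /(_ g hg phi)] := ltensor_bounded u.
have [->|gphi] := eqVneq (lipsharp_norm g * opnorm phi) 0.
  by rewrite mulr0 mul0r.
move=> _; move: gphi; rewrite mulf_eq0 negb_or => /andP[gN0 phiN0].
have g_gt0 : 0 < lipsharp_norm g by rewrite lt_neqAle eq_sym gN0 Lip_ge0.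
have phi_gt0 : 0 < opnorm phi.
  by rewrite lt_neqAle eq_sym phiN0 opnorm_ge0//; exact: dual_bounded.
pose a := of_real k (lipsharp_norm g)^-1; pose b := of_real k (opnorm phi)^-1.
have na : rnorm (a : K^o) = (lipsharp_norm g)^-1.
  by rewrite rnorm_of_real gtr0_norm// invr_gt0.
have nb : rnorm (b : K^o) = (opnorm phi)^-1.
  by rewrite rnorm_of_real gtr0_norm// invr_gt0.
have [hag ag1] := lipsharp_scale a hg.
have := lip_inj_ub u hag (phi := b *: phi).
have -> : rank1 hag (b *: phi) = (a * b) *: rank1 hg phi.
  apply/val_inj/funext => x /=; rewrite !fctE /=.
  by rewrite !scalerA; congr (_ *: _); rewrite mulrAC.
have -> : u ((a * b) *: rank1 hg phi) = a * b * u (rank1 hg phi).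
  exact: linear_funZ (ltensor_linear u).
rewrite !rnormM na nb -invfM ler_pdivrMl ?mulr_gt0//; apply.
  by apply: le_trans ag1 _; rewrite na mulVf.
by apply: le_trans (opnorm_scale _ _) _; rewrite nb mulVf.
Qed.

Lemma lip_injZ_le (a : K) u : lip_inj (a *: u) <= rnorm (a : K^o) * lip_inj u.
Proof.
apply: lip_inj_le => g hg phi g1 phi1.
by rewrite ltensor_evalZ rnormM ler_wpM2l ?rnorm_ge0 ?lip_inj_ub.
Qed.

(** For nonzero [a], the reverse inequality is the previous one for [a^-1] and
[a *: u]. *)
Lemma lip_injZ (a : K) u : lip_inj (a *: u) = rnorm (a : K^o) * lip_inj u.
Proof.
apply/eqP; rewrite eq_le lip_injZ_le/=.
have [->|a0] := eqVneq a 0; first by rewrite rnorm0 mul0r lip_inj_ge0.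
rewrite -[in leLHS](scalerK a0 u).
apply: le_trans (ler_wpM2l (rnorm_ge0 _) (lip_injZ_le a^-1 _)) _.
rewrite mulrA -rnormM mulfV//.
have -> : (1 : K) = of_real k 1 by rewrite of_real1.
by rewrite rnorm_of_real normr1 mul1r.
Qed.

Lemma lip_injD u v : lip_inj (u + v) <= lip_inj u + lip_inj v.
Proof.
apply: lip_inj_le => g hg phi g1 phi1; rewrite ltensor_evalD.
by apply: le_trans (rnormD _ _) _; rewrite lerD ?lip_inj_ub.
Qed.

(** Induction on a list of points outside of which [f] vanishes, among those of
the representation: a bump at [z] times [f z] clears one point at a time. *)
Lemma rank1_separating u :
  (forall g (hg : is_lipsharp x0 g) phi, u (rank1 hg phi) = 0) -> u = 0.
Proof.
have [n [x [y [e ->]]]] := ltensor_repr u => u0.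
pose P := codom x ++ codom y.
suff vanish (Z : seq X) f : (forall w, w \in P -> w \notin Z -> f w = 0) ->
    delta_sum x0 x y e f = 0.
  do 2!apply: val_inj; apply/funext => f; apply: (vanish P) => w wP.
  by rewrite wP.
elim: Z f => [|z Z IH] f f0.
  rewrite delta_sum_eval big1// => i _.
  by rewrite !f0 ?mem_cat ?codom_f ?orbT// subrr.
have fx0 : f x0 = 0 by have /asboolP[] := lip0_dual_valP f.
(* Every map vanishes at the base point, where no bump exists. *)
have [zx0|zx0] := eqVneq z x0.
  apply: IH => w wP wZ; have [->|wz] := eqVneq w x0; first exact: fx0.
  by apply: f0 => //; rewrite inE zx0 negb_or wz.
have [||g [hg gz g0]] :=
  @lipsharp_bump R k X x0 z (x0 :: [seq w <- P | w != z]).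
- by rewrite inE negb_or zx0 mem_filter eqxx.
- by rewrite inE eqxx.
have -> : f = 1 *: rank1 hg (f z) + (f - rank1 hg (f z)).
  by rewrite scale1r addrC subrK.
rewrite ltensor_linear u0 scaler0 add0r; apply: IH => w wP wZ.
have -> : (f - rank1 hg (f z)) w = f w - (g w : K) *: f z by [].
have [->|wz] := eqVneq w z; first by rewrite gz scale1r subrr.
rewrite g0 ?inE ?mem_filter ?wz ?wP ?orbT// scale0r subr0.
by apply: f0 => //; rewrite inE negb_or wz.
Qed.

Lemma lip_inj_eq0 u : lip_inj u = 0 -> u = 0.
Proof.
move=> u0; apply: rank1_separating => g hg phi; apply: (@rnorm_eq0 R k K^o).
apply/eqP; rewrite eq_le rnorm_ge0 andbT.
by apply: le_trans (lip_inj_dual _ _ _) _; rewrite u0 mulr0.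
Qed.

(** The upper bound multiplies the bounds for the two factors; it is attained by
the distance to [y] and a norming functional of [e]. *)
Lemma lip_inj_delta x y (e : E) : lip_inj (delta x0 x y e) = d x y * rnorm e.
Proof.
have deltaE g (hg : is_lipsharp x0 g) phi :
    delta x0 x y e (rank1 hg phi) = (g x - g y) * phi e.
  by rewrite /= /boxtimes_fun /= -scalerBl.
apply/eqP; rewrite eq_le; apply/andP; split.
  apply: lip_inj_le => g hg phi g1 phi1; rewrite deltaE rnormM.
  rewrite ler_pM ?rnorm_ge0//.
    by apply: le_trans (lipsharpP _ _ hg) _; rewrite ler_piMl ?mdist_ge0.
  by apply: le_trans (dual_le _ _) _; rewrite ler_piMl ?rnorm_ge0.
have [hg g1] := lipsharp_dist k x0 y.
have [phi [phi1 phie]] := norming_functional e.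
apply: le_trans (lip_inj_ub _ hg g1 phi1).
rewrite deltaE rnormM ler_pM ?mdist_ge0 ?rnorm_ge0//.
rewrite -of_realB rnorm_of_real mdistxx.
by rewrite (_ : _ - _ = d x y) ?ler_norm//; ring.
Qed.

Lemma lip_inj_dualizable : dualizable (@lip_inj R k X x0 E).
Proof.
move=> g phi hg n x y e; rewrite -(delta_sum_pairing phi hg).
exact: lip_inj_dual.
Qed.

(** Moves [h] and [T] from the tensor onto the pair that it is tested on. *)
Lemma lip_inj_uniform : uniform_norm (@lip_inj R k X x0 E).
Proof.
move=> h T hh bT n x y e; apply: lip_inj_le => g hg phi g1 phi1.
have [hgh gh_le] := lipsharp_comp hg hh.
have [psi [psiE psi_le]] := dual_comp phi bT.
rewrite delta_sum_pairing.
have -> : pairing g phi (h \o x) (h \o y) (T \o e) = pairing (g \o h) psi x y e.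
  by apply: eq_bigr => i _; rewrite psiE.
apply: le_trans (lip_inj_dualizable _ hgh _ _ _) _.
rewrite ler_wpM2r ?lip_inj_ge0//.
apply: ler_pM; rewrite ?Lip_ge0 ?opnorm_ge0//; first exact: dual_bounded.
  by apply: le_trans gh_le _; rewrite ler_piMr ?Lip_ge0.
by apply: le_trans psi_le _; rewrite ler_piMr ?opnorm_ge0.
Qed.

End InjectiveNorm.

Theorem theorem5p2 (R : realType) (k : scalar_kind) (X : metricType R) (x0 : X)
    (E : completeNormedModType (scalars R k)) :
  lip_crossnorm (@lip_inj R k X x0 E) /\
  dualizable (@lip_inj R k X x0 E) /\
  uniform_norm (@lip_inj R k X x0 E).
Proof.
split; last by split; [exact: lip_inj_dualizable|exact: lip_inj_uniform].
split; last exact: lip_inj_delta.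
split; [exact: lip_inj_ge0|exact: lip_inj_eq0|exact: lip_injZ|].
exact: lip_injD.
Qed.
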